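(* Let $p:\mathscr{E}\to\mathscr{B}$ be a functor with an image structure $(\star,\lambda)$. Then every comprehension structure with section on $p$ with section $\star$ (that is, every right adjoint $[-]:\mathscr{E}\to\mathscr{B}$ of $\star:\mathscr{B}\to\mathscr{E}$) defines a comprehension structure with image on $p$: the image functor $\mathbf{image}:\mathscr{B}^{\to}\to\mathscr{E}$ associated with $(\star,\lambda)$ has a right adjoint $\mathscr{P}:\mathscr{E}\to\mathscr{B}^{\to}$ in the fibered sense above $\mathscr{B}$.
   Context: A section of a functor $p:\mathscr{E}\to\mathscr{B}$ is a functor $\star:\mathscr{B}\to\mathscr{E}$, written $A\mapsto\star_A$, with $p\circ\star=\mathrm{id}_{\mathscr{B}}$. A comprehension structure with section on $p$ is a section $\star$ of $p$ together with a right adjoint functor $[-]:\mathscr{E}\to\mathscr{B}$ of $\star$. A morphism $f:R\to S$ of $\mathscr{E}$ is above $u$ when $p(f)=u$. A morphism $f:R\to S$ above $u:A\to B$ is opcartesian when, for every $v:B\to B'$ in $\mathscr{B}$ and every object $S'$ with $p(S')=B'$, precomposition with $f$ is a bijection from the morphisms $S\to S'$ above $v$ to the morphisms $R\to S'$ above $v\circ u$. An image structure on $p$ is a pair $(\star,\lambda)$ of a section $\star$ of $p$ and a family of opcartesian morphisms $\lambda_u:\star_A\to\exists_u[\star_A]$ above $u$, one for each morphism $u:A\to B$ of $\mathscr{B}$, such that $\lambda_{\mathrm{id}_A}$ is the identity of $\star_A$ for every $A$. Let $\mathscr{B}^{\to}$ be the arrow category of $\mathscr{B}$ and $\mathbf{cod}:\mathscr{B}^{\to}\to\mathscr{B}$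 the codomain functor. The associated image functor $\mathbf{image}:\mathscr{B}^{\to}\to\mathscr{E}$ sends $u:A\to B$ to $\exists_u[\star_A]$, and sends a morphism from $u:A\to B$ to $u':A'\to B'$ given by $w:A\to A'$ and $v:B\to B'$ with $v\circ u=u'\circ w$ to the unique morphism $h:\exists_u[\star_A]\to\exists_{u'}[\star_{A'}]$ above $v$ such that $h\circ\lambda_u=\lambda_{u'}\circ\star_w$. It satisfies $p\circ\mathbf{image}=\mathbf{cod}$. A right adjoint of $\mathbf{image}$ in the fibered sense above $\mathscr{B}$ is a functor $\mathscr{P}:\mathscr{E}\to\mathscr{B}^{\to}$ with $\mathbf{cod}\circ\mathscr{P}=p$, together with an adjunction $\mathbf{image}\dashv\mathscr{P}$ whose unit and counit are vertical (sent to identities by $\mathbf{cod}$ and $p$ respectively). A comprehension structure with image on $p$ is a functor $\mathbf{image}:\mathscr{B}^{\to}\to\mathscr{E}$ with $p\circ\mathbf{image}=\mathbf{cod}$ together with such a right adjoint. *)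

(* Defs.v *)
(* Stdlib world *)
From Stdlib Require Import ProofIrrelevance IndefiniteDescription.

Set Implicit Arguments.
Unset Strict Implicit.
Unset Printing Implicit Defensive.

Declare Scope cat_scope.
Delimit Scope cat_scope with cat.
Open Scope cat_scope.

Record Category : Type := {
  ob :> Type;
  hom : ob -> ob -> Type;
  idm : forall A, hom A A;
  comp : forall A B C, hom B C -> hom A B -> hom A C;
  comp_idl : forall A B (f : hom A B), comp (idm B) f = f;
  comp_idr : forall A B (f : hom A B), comp f (idm A) = f;
  comp_assoc : forall A B C D (h : hom C D) (g : hom B C) (f : hom A B),
    comp h (comp g f) = comp (comp h g) f }.

Arguments hom {c} A B.
Arguments idm {c} A.
Arguments comp {c A B C} g f.
Notation "g ∘ f" := (comp g f) (at level 40, left associativity) : cat_scope.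

(* Equality of morphisms whose endpoints are not syntactically the same:
   the domains agree, the codomains agree, and the morphisms agree. For
   morphisms with the same endpoints it is Leibniz equality ([hom_eq_eq]). *)
Inductive hom_eq (C : Category) (A B : C) (f : hom A B) :
    forall A' B' : C, hom A' B' -> Prop :=
  hom_eq_refl : hom_eq f f.
Notation "f ~= g" := (hom_eq f g) (at level 70) : cat_scope.

Record Functor (C D : Category) : Type := {
  fobj :> C -> D;
  fmap : forall A B : C, hom A B -> hom (fobj A) (fobj B);
  fmap_id : forall A : C, fmap (idm A) = idm (fobj A);
  fmap_comp : forall (A B X : C) (g : hom B X) (f : hom A B),
    fmap (g ∘ f) = fmap g ∘ fmap f }.

Arguments fmap {C D} F {A B} f : rename.

Definition fid (C : Category) : Functor C C :=
  {| fobj := fun A : C => A;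
     fmap := fun A B (f : hom A B) => f;
     fmap_id := fun A => eq_refl;
     fmap_comp := fun A B X g f => eq_refl |}.

Definition fcomp (C D E : Category) (G : Functor D E) (F : Functor C D) :
  Functor C E.
Proof.
refine {| fobj := fun A => G (F A);
          fmap := fun A B (f : hom A B) => fmap G (fmap F f) |}.
- intros A; now rewrite !fmap_id.
- intros A B X g f; now rewrite !fmap_comp.
Defined.

Record NatTrans (C D : Category) (F G : Functor C D) : Type := {
  component :> forall A : C, hom (F A) (G A);
  naturality : forall (A B : C) (f : hom A B),
    component B ∘ fmap F f = fmap G f ∘ component A }.

Record Adjunction (C D : Category) (L : Functor C D) (R : Functor D C) :
    Type := {
  unit : NatTrans (fid C) (fcomp R L);
  counit : NatTrans (fcomp L R) (fid D);
  triangle_l : forall A : C, counit (L A) ∘ fmap L (unit A) = idm (L A);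
  triangle_r : forall X : D, fmap R (counit X) ∘ unit (R X) = idm (R X) }.

Record ArrowOb (B : Category) : Type := MkArrow {
  src : B;
  tgt : B;
  arr : hom src tgt }.

Record ArrowHom (B : Category) (u u' : ArrowOb B) : Type := MkArrowHom {
  top : hom (src u) (src u');
  bot : hom (tgt u) (tgt u');
  square : bot ∘ arr u = arr u' ∘ top }.

Lemma ArrowHom_ext (B : Category) (u u' : ArrowOb B) (f g : ArrowHom u u') :
  top f = top g -> bot f = bot g -> f = g.
Proof.
destruct f as [w v e], g as [w' v' e']; simpl; intros -> ->.
f_equal; apply proof_irrelevance.
Qed.

Definition ArrowId (B : Category) (u : ArrowOb B) : ArrowHom u u.
Proof.
refine (@MkArrowHom B u u (idm _) (idm _) _).
now rewrite comp_idl, comp_idr.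
Defined.

Definition ArrowComp (B : Category) (u u' u'' : ArrowOb B)
  (g : ArrowHom u' u'') (f : ArrowHom u u') : ArrowHom u u''.
Proof.
refine (@MkArrowHom B u u'' (top g ∘ top f) (bot g ∘ bot f) _).
now rewrite <- comp_assoc, square, !comp_assoc, square.
Defined.

Definition Arrow (B : Category) : Category.
Proof.
refine {| ob := ArrowOb B;
          hom := @ArrowHom B;
          idm := @ArrowId B;
          comp := @ArrowComp B |}.
- intros; apply ArrowHom_ext; apply comp_idl.
- intros; apply ArrowHom_ext; apply comp_idr.
- intros; apply ArrowHom_ext; apply comp_assoc.
Defined.

Definition cod (B : Category) : Functor (Arrow B) B :=
  {| fobj := fun u : Arrow B => tgt u;
     fmap := fun (u u' : Arrow B) (f : hom u u') => bot f;
     fmap_id := fun u => eq_refl;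
     fmap_comp := fun u u' u'' g f => eq_refl |}.

Definition above (E B : Category) (p : Functor E B) (R S : E) (f : hom R S)
    (A A' : B) (u : hom A A') : Prop :=
  fmap p f ~= u.

(* The [exists!] says that [fun h => h ∘ f] is a bijection from the
   morphisms [S -> S'] above [v] to the morphisms [R -> S'] above [v ∘ u]. *)
Definition opcartesian (E B : Category) (p : Functor E B)
    (R S : E) (f : hom R S) (A A' : B) (u : hom A A') : Prop :=
  above p f u /\
  forall (B' : B) (v : hom A' B') (S' : E), p S' = B' ->
  forall g : hom R S', above p g (v ∘ u) ->
  exists! h : hom S S', above p h v /\ h ∘ f = g.

Record Section (E B : Category) (p : Functor E B) : Type := {
  sec_functor :> Functor B E;
  sec_eq : fcomp p sec_functor = fid B }.

Record SectionComprehension (E B : Category) (p : Functor E B) : Type := {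
  sc_section : Section p;
  sc_compr : Functor E B;
  sc_adj : Adjunction sc_section sc_compr }.

Record ImageStructure (E B : Category) (p : Functor E B) : Type := {
  is_section : Section p;
  is_ex : forall (A A' : B), hom A A' -> E;
  is_lambda : forall (A A' : B) (u : hom A A'),
    hom (is_section A) (is_ex u);
  is_opcartesian : forall (A A' : B) (u : hom A A'),
    opcartesian p (is_lambda u) u;
  (* in particular [is_ex (idm A) = is_section A] *)
  is_lambda_id : forall A : B, is_lambda (idm A) ~= idm (is_section A) }.

Record FiberedRightAdjoint (E B : Category) (p : Functor E B)
    (im : Functor (Arrow B) E) : Type := {
  fra_functor : Functor E (Arrow B);
  fra_over : fcomp (cod B) fra_functor = p;
  fra_adj : Adjunction im fra_functor;
  fra_unit_vertical : forall u : Arrow B,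
    above (cod B) (unit fra_adj u) (idm (cod B u));
  fra_counit_vertical : forall R : E,
    above p (counit fra_adj R) (idm (p R)) }.

Record ImageComprehension (E B : Category) (p : Functor E B) : Type := {
  ic_image : Functor (Arrow B) E;
  ic_over : fcomp p ic_image = cod B;
  ic_right_adjoint : FiberedRightAdjoint p ic_image }.

Lemma hom_eq_cod (C : Category) (A B A' B' : C) (f : hom A B) (g : hom A' B') :
  f ~= g -> B = B'.
Proof. now destruct 1. Qed.

Lemma hom_eq_eq (C : Category) (A B : C) (f g : hom A B) : f ~= g -> f = g.
Proof.
intros H.
assert (K : forall (A' B' : C) (k : hom A' B'), f ~= k ->
  existT (fun x : C * C => hom (fst x) (snd x)) (A, B) f =
  existT (fun x : C * C => hom (fst x) (snd x)) (A', B') k)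
  by (destruct 1; reflexivity).
exact (inj_pair2 _ (fun x : C * C => hom (fst x) (snd x)) _ _ _ (K _ _ _ H)).
Qed.

Lemma eq_hom_eq (C : Category) (A B : C) (f g : hom A B) : f = g -> f ~= g.
Proof. now intros ->. Qed.

Lemma hom_eq_trans (C : Category) (A B A' B' A'' B'' : C)
    (f : hom A B) (g : hom A' B') (h : hom A'' B'') :
  f ~= g -> g ~= h -> f ~= h.
Proof. now intros [] H. Qed.

Lemma hom_eq_comp (C : Category) (A X Y A' X' Y' : C)
    (f : hom A X) (g : hom X Y) (f' : hom A' X') (g' : hom X' Y') :
  f ~= f' -> g ~= g' -> g ∘ f ~= g' ∘ f'.
Proof.
intros Hf; destruct Hf; intros Hg.
pose proof (hom_eq_cod Hg); subst.
now rewrite (hom_eq_eq Hg).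
Qed.

Lemma section_above (E B : Category) (p : Functor E B) (s : Section p)
    (A A' : B) (u : hom A A') : above p (fmap s u) u.
Proof.
unfold above; change (fmap (fcomp p s) u ~= u).
now rewrite (sec_eq s).
Qed.

Section ImageFunctor.

Variables (E B : Category) (p : Functor E B) (I : ImageStructure p).

Definition image_ob (u : Arrow B) : E := is_ex I (arr u).

Definition image_spec (u u' : Arrow B) (f : hom u u')
    (h : hom (image_ob u) (image_ob u')) : Prop :=
  above p h (bot f) /\
  h ∘ is_lambda I (arr u) = is_lambda I (arr u') ∘ fmap (is_section I) (top f).

Lemma image_unique_exists (u u' : Arrow B) (f : hom u u') :
  exists! h, image_spec f h.
Proof.
apply (proj2 (is_opcartesian I (arr u))).
- exact (hom_eq_cod (proj1 (is_opcartesian I (arr u')))).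
- unfold above; rewrite fmap_comp, square.
  apply hom_eq_comp; [apply section_above | apply is_opcartesian].
Qed.

Definition image_map (u u' : Arrow B) (f : hom u u') :
    hom (image_ob u) (image_ob u') :=
  proj1_sig (constructive_definite_description _ (image_unique_exists f)).

Lemma image_mapP (u u' : Arrow B) (f : hom u u') : image_spec f (image_map f).
Proof. exact (proj2_sig (constructive_definite_description _ _)). Qed.

Lemma image_map_unique (u u' : Arrow B) (f : hom u u') h :
  image_spec f h -> image_map f = h.
Proof.
intros Hh; destruct (image_unique_exists f) as [k [_ Hk]].
now rewrite <- (Hk _ Hh), <- (Hk _ (image_mapP f)).
Qed.

Lemma ex_over (A A' : B) (u : hom A A') : p (is_ex I u) = A'.
Proof. exact (hom_eq_cod (proj1 (is_opcartesian I u))). Qed.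

Lemma image_map_id (u : Arrow B) : image_map (idm u) = idm (image_ob u).
Proof.
apply image_map_unique; split.
- unfold above; rewrite fmap_id; simpl.
  unfold image_ob; now rewrite ex_over.
- simpl; now rewrite fmap_id, comp_idl, comp_idr.
Qed.

Lemma image_map_comp (u u' u'' : Arrow B) (g : hom u' u'') (f : hom u u') :
  image_map (g ∘ f) = image_map g ∘ image_map f.
Proof.
destruct (image_mapP f) as [Hf ef], (image_mapP g) as [Hg eg].
apply image_map_unique; split.
- unfold above; rewrite fmap_comp; now apply hom_eq_comp.
- rewrite <- comp_assoc, ef; simpl; rewrite fmap_comp.
  rewrite (comp_assoc (image_map g)), comp_assoc; f_equal; exact eg.
Qed.

Definition image_functor : Functor (Arrow B) E :=
  {| fobj := image_ob;
     fmap := image_map;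
     fmap_id := image_map_id;
     fmap_comp := image_map_comp |}.

End ImageFunctor.

(* Main.v *)
(** The right adjoint sends an object [R] to the arrow [p(ε_R) : [R] -> p R],
where [ε] is the counit of [⋆ ⊣ [-]]. Morphisms [∃_u[⋆_A] -> R] above [v] are,
by opcartesianness of [λ_u], morphisms [⋆_A -> R] above [v ∘ u], which by the
adjunction are morphisms [w : A -> [R]] with [p(ε_R) ∘ w = v ∘ u], that is,
squares from [u] to [p(ε_R)] with bottom side [v]. *)

From Stdlib Require Import ProofIrrelevance IndefiniteDescription
  FunctionalExtensionality.
Require Import Defs.

Set Implicit Arguments.
Unset Strict Implicit.
Unset Printing Implicit Defensive.

(** * Transport of morphisms and equality of functors *)

Lemma hom_eq_sym (C : Category) (A B A' B' : C) (f : hom A B) (g : hom A' B') :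
  f ~= g -> g ~= f.
Proof. now destruct 1. Qed.

(** [p (star A) = A] and [p (is_ex I u) = A'] are only propositional, so a morphism of [B] obtained
    through [p] needs its domain transported before it can be a side of a square. *)
Definition cast_dom (C : Category) (A A' B : C) (e : A = A') (f : hom A B) :
    hom A' B :=
  eq_rect A (fun X => hom X B) f A' e.

Lemma cast_dom_hom_eq (C : Category) (A A' B : C) (e : A = A') (f : hom A B) :
  cast_dom e f ~= f.
Proof. now destruct e. Qed.

(** Equality of the object maps is read off the codomains of the images of identities. *)
Lemma Functor_ext (C D : Category) (F G : Functor C D) :
  (forall (A B : C) (f : hom A B), fmap F f ~= fmap G f) -> F = G.
Proof.
destruct F as [o m i c], G as [o' m' i' c']; simpl; intros H.
assert (Ho : o = o').
{ apply functional_extensionality; intros A.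
  exact (hom_eq_cod (H _ _ (idm A))). }
subst o'.
assert (Hm : m = m').
{ do 3 (apply functional_extensionality_dep; intros).
  apply hom_eq_eq, H. }
subst m'; f_equal; apply proof_irrelevance.
Qed.

Lemma above_comp (E B : Category) (p : Functor E B) (R S T : E)
    (g : hom S T) (f : hom R S) (X Y Z : B) (v : hom Y Z) (u : hom X Y) :
  above p g v -> above p f u -> above p (g ∘ f) (v ∘ u).
Proof.
unfold above; intros Hg Hf; rewrite fmap_comp; now apply hom_eq_comp.
Qed.

(** The uniqueness half of opcartesianness: [h] and [k] both factor [h ∘ f], which is above
    [v ∘ u]. *)
Lemma opcartesian_cancel (E B : Category) (p : Functor E B) (R S S' : E)
    (f : hom R S) (X Y Z : B) (u : hom X Y) (v : hom Y Z) (h k : hom S S') :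
  opcartesian p f u -> above p h v -> above p k v -> h ∘ f = k ∘ f -> h = k.
Proof.
intros [Hf Huniv] Hh Hk e.
destruct (Huniv _ v S' (hom_eq_cod Hh) (h ∘ f)) as [l [_ Hl]].
- now apply above_comp.
- rewrite <- (Hl h), <- (Hl k); auto.
Qed.

(** The unit at [A] is the unique factorization of [idm (L A)] through [eps]; its naturality and the
    second triangle hold because transposition along [eps] is injective. The conclusion keeps track
    of the counit so that its verticality can be checked afterwards. *)
Lemma adjunction_of_universal_counit (C D : Category) (L : Functor C D)
    (R : Functor D C) (eps : forall X : D, hom (L (R X)) X) :
  (forall (X Y : D) (f : hom X Y), eps Y ∘ fmap L (fmap R f) = f ∘ eps X) ->
  (forall (A : C) (X : D) (h : hom (L A) X),
     exists! w : hom A (R X), eps X ∘ fmap L w = h) ->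
  exists a : Adjunction L R, forall X : D, counit a X = eps X.
Proof.
intros nat_eps Huniv.
assert (Hinj : forall (A : C) (X : D) (w w' : hom A (R X)),
  eps X ∘ fmap L w = eps X ∘ fmap L w' -> w = w').
{ intros A X w w' e.
  destruct (Huniv A X (eps X ∘ fmap L w)) as [l [_ Hl]].
  rewrite <- (Hl w), <- (Hl w'); auto. }
assert (Heta : exists eta : forall A : C, hom A (R (L A)),
  forall A : C, eps (L A) ∘ fmap L (eta A) = idm (L A)).
{ pose (t A := constructive_definite_description _
    (Huniv A (L A) (idm (L A)))).
  exists (fun A => proj1_sig (t A)); intros A; exact (proj2_sig (t A)). }
destruct Heta as [eta etaP].
assert (nat_eta : forall (A B : C) (f : hom A B),
  eta B ∘ f = fmap R (fmap L f) ∘ eta A).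
{ intros A B f; apply Hinj.
  rewrite !fmap_comp, !comp_assoc, etaP, nat_eps, comp_idl.
  now rewrite <- comp_assoc, etaP, comp_idr. }
assert (tri : forall X : D, fmap R (eps X) ∘ eta (R X) = idm (R X)).
{ intros X; apply Hinj.
  rewrite fmap_comp, comp_assoc, nat_eps, <- comp_assoc.
  now rewrite etaP, fmap_id. }
exists (@Build_Adjunction C D L R
  (@Build_NatTrans C C (fid C) (fcomp R L) eta nat_eta)
  (@Build_NatTrans D D (fcomp L R) (fid D) eps nat_eps) etaP tri).
reflexivity.
Qed.

Lemma image_functor_over (E B : Category) (p : Functor E B)
    (I : ImageStructure p) : fcomp p (image_functor I) = cod B.
Proof. apply Functor_ext; intros u u' f; apply (image_mapP I f). Qed.

(** * The fibered right adjoint of the image functor *)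

Section RightAdjoint.

Variables (E B : Category) (p : Functor E B) (I : ImageStructure p)
  (F : Functor E B) (adj : Adjunction (is_section I) F).

Local Notation star := (sec_functor (is_section I)).

Let eps (R : E) : hom (star (F R)) R := counit adj R.
Let eta (A : B) : hom A (F (star A)) := unit adj A.

Lemma counit_nat (R S : E) (f : hom R S) :
  eps S ∘ fmap star (fmap F f) = f ∘ eps R.
Proof. exact (naturality (counit adj) f). Qed.

Lemma section_ob_over (A : B) : p (star A) = A.
Proof. exact (hom_eq_cod (section_above (is_section I) (idm A))). Qed.

Definition compr_ob (R : E) : Arrow B :=
  MkArrow (cast_dom (section_ob_over (F R)) (fmap p (eps R))).

Lemma counit_above (R : E) : above p (eps R) (arr (compr_ob R)).
Proof. apply hom_eq_sym, cast_dom_hom_eq. Qed.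

(** This is the naturality square of [eps] at [f], projected by [p]. *)
Lemma compr_square (R S : E) (f : hom R S) :
  fmap p f ∘ arr (compr_ob R) = arr (compr_ob S) ∘ fmap F f.
Proof.
apply hom_eq_eq.
apply hom_eq_trans with (g := fmap p (f ∘ eps R)).
- apply hom_eq_sym, above_comp; [apply hom_eq_refl | apply counit_above].
- rewrite <- counit_nat.
  apply above_comp; [apply counit_above | apply section_above].
Qed.

Definition compr_map (R S : E) (f : hom R S) :
    hom (compr_ob R) (compr_ob S) :=
  @MkArrowHom B (compr_ob R) (compr_ob S) (fmap F f) (fmap p f)
    (compr_square f).

Definition compr_functor : Functor E (Arrow B).
Proof.
refine {| fobj := compr_ob; fmap := compr_map |}.
- intros R; apply ArrowHom_ext; apply fmap_id.
- intros R S T g f; apply ArrowHom_ext; apply fmap_comp.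
Defined.

Lemma compr_functor_over : fcomp (cod B) compr_functor = p.
Proof.
apply Functor_ext; intros; apply hom_eq_refl.
Qed.

(** The counit of the new adjunction at [R]: the vertical factorization of [eps R] through the
    opcartesian morphism over [compr_ob R]. *)
Definition image_counit_spec (R : E)
    (k : hom (is_ex I (arr (compr_ob R))) R) : Prop :=
  above p k (idm (p R)) /\ k ∘ is_lambda I (arr (compr_ob R)) = eps R.

Lemma image_counit_unique_exists (R : E) : exists! k, @image_counit_spec R k.
Proof.
apply (proj2 (is_opcartesian I (arr (compr_ob R)))); [reflexivity|].
rewrite comp_idl; apply counit_above.
Qed.

Definition image_counit_map (R : E) : hom (is_ex I (arr (compr_ob R))) R :=
  proj1_sig (constructive_definite_description _ (image_counit_unique_exists R)).

Lemma image_counit_mapP (R : E) : image_counit_spec (image_counit_map R).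
Proof. exact (proj2_sig (constructive_definite_description _ _)). Qed.

Lemma image_counit_fmap_above (u : Arrow B) (R : E)
    (f : hom u (compr_ob R)) :
  above p (image_counit_map R ∘ image_map I f) (bot f).
Proof.
rewrite <- (comp_idl (bot f)); apply above_comp.
- apply image_counit_mapP.
- apply image_mapP.
Qed.

(** Precomposition with [is_lambda I (arr u)] sees only the top side of the square, while [p] sees
    only the bottom side; these two readings determine both the square and its transpose. *)
Lemma image_counit_fmap_lambda (u : Arrow B) (R : E)
    (f : hom u (compr_ob R)) :
  image_counit_map R ∘ image_map I f ∘ is_lambda I (arr u)
  = eps R ∘ fmap star (top f).
Proof.
pose proof (proj2 (image_mapP I f)) as Hf; unfold image_ob in *.
rewrite <- comp_assoc, Hf, comp_assoc.
now rewrite (proj2 (image_counit_mapP R)).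
Qed.

(** Both sides are above [fmap p f], so they may be compared after precomposition with the
    opcartesian morphism, where the equation becomes naturality of [eps]. *)
Lemma image_counit_naturality (R S : E) (f : hom R S) :
  image_counit_map S ∘ image_map I (compr_map f) = f ∘ image_counit_map R.
Proof.
apply (opcartesian_cancel (v := fmap p f)
  (is_opcartesian I (arr (compr_ob R)))).
- apply (image_counit_fmap_above (compr_map f)).
- rewrite <- (comp_idr (fmap p f)); apply above_comp;
    [apply hom_eq_refl | apply image_counit_mapP].
- etransitivity; [apply (image_counit_fmap_lambda (compr_map f))|].
  rewrite <- comp_assoc, (proj2 (image_counit_mapP R)); apply counit_nat.
Qed.

Lemma section_transpose (A : B) (R : E) (g : hom (star A) R) :
  eps R ∘ fmap star (fmap F g ∘ eta A) = g.
Proof.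
assert (tri : eps (star A) ∘ fmap star (eta A) = idm (star A))
  by exact (triangle_l adj A).
rewrite fmap_comp, comp_assoc, counit_nat, <- comp_assoc, tri.
apply comp_idr.
Qed.

Lemma section_transpose_unique (A : B) (R : E) (w : hom A (F R)) :
  fmap F (eps R ∘ fmap star w) ∘ eta A = w.
Proof.
assert (tri : fmap F (eps R) ∘ eta (F R) = idm (F R))
  by exact (triangle_r adj R).
assert (nat : eta (F R) ∘ w = fmap F (fmap star w) ∘ eta A)
  by exact (naturality (unit adj) w).
rewrite fmap_comp, <- comp_assoc, <- nat, comp_assoc, tri.
apply comp_idl.
Qed.

Lemma image_counit_universal (u : Arrow B) (R : E)
    (h : hom (image_functor I u) R) :
  exists! f : hom u (compr_functor R),
    image_counit_map R ∘ fmap (image_functor I) f = h.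
Proof.
(* Since the counit is vertical, the bottom side can only be [p] of [h]; the top side [w] is the
   transpose under [adj] of [h] restricted along [is_lambda I (arr u)]. *)
set (v := cast_dom (ex_over I (arr u)) (fmap p h) : hom (tgt u) (p R)).
assert (Hv : above p h v) by apply hom_eq_sym, cast_dom_hom_eq.
set (g := h ∘ is_lambda I (arr u)).
set (w := fmap F g ∘ eta (src u)).
(* Both composites are [p] of [g], once as [h] after the opcartesian morphism and once as
   [eps R ∘ fmap star w]. *)
assert (Hsq : v ∘ arr u = arr (compr_ob R) ∘ w).
{ apply hom_eq_eq, hom_eq_trans with (g := fmap p g).
  - apply hom_eq_sym, above_comp; [exact Hv | apply is_opcartesian].
  - rewrite <- (section_transpose g).
    apply above_comp; [apply counit_above | apply section_above]. }
exists (@MkArrowHom B u (compr_ob R) w v Hsq); split.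
- apply (opcartesian_cancel (v := v) (is_opcartesian I (arr u))).
  + apply (image_counit_fmap_above (@MkArrowHom B u (compr_ob R) w v Hsq)).
  + exact Hv.
  + etransitivity;
      [apply (image_counit_fmap_lambda (@MkArrowHom B u (compr_ob R) w v Hsq))|].
    apply section_transpose.
- intros f Hf; apply ArrowHom_ext; simpl.
  + unfold w, g; rewrite <- Hf.
    etransitivity; [|apply section_transpose_unique].
    do 2 f_equal; apply (image_counit_fmap_lambda f).
  + apply hom_eq_eq, hom_eq_trans with (g := fmap p h).
    * apply hom_eq_sym, Hv.
    * rewrite <- Hf; apply (image_counit_fmap_above f).
Qed.

(** Wrapped in [inhabited] because the adjunction is only obtained from an existential
    proposition. *)
Lemma image_fibered_right_adjoint :
  inhabited (FiberedRightAdjoint p (image_functor I)).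
Proof.
destruct (adjunction_of_universal_counit (L := image_functor I)
  (R := compr_functor) image_counit_naturality image_counit_universal)
  as [a Ha].
constructor.
refine (@Build_FiberedRightAdjoint E B p (image_functor I)
  compr_functor compr_functor_over a _ _).
(* Verticality of the unit follows from the first triangle: the composite there is an identity, and
   it is above the bottom side of the unit because the counit is vertical. *)
- intros u; unfold above.
  pose proof (triangle_l a u) as Ht; rewrite Ha in Ht.
  apply hom_eq_trans
    with (g := fmap p (image_counit_map (image_ob I u)
                         ∘ image_map I (unit a u))).
  + apply hom_eq_sym, (image_counit_fmap_above (unit a u)).
  + apply hom_eq_trans with (g := fmap p (idm (image_ob I u))).
    * exact (eq_hom_eq (f_equal _ Ht)).
    * rewrite fmap_id; unfold image_ob; now rewrite ex_over.
- intros R; rewrite Ha; apply image_counit_mapP.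
Qed.

End RightAdjoint.

Theorem proposition8 (E B : Category) (p : Functor E B)
    (I : ImageStructure p) (K : SectionComprehension p)
    (HK : sc_section K = is_section I) :
  exists C : ImageComprehension p, ic_image C = image_functor I.
Proof.
destruct K as [s F adj]; simpl in HK; subst s.
destruct (image_fibered_right_adjoint adj) as [a].
now exists (Build_ImageComprehension (image_functor_over I) a).
Qed.
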